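(* Let $X$ be an infinite dimensional Banach space such that the norm $N^A_X$ on $\mathbb{R}^2$ is symmetric. Then $X$ is weak-net-stable and has property $(sM)$ if and only if $\bar{\delta}_X=\bar{\rho}_X$.
   Context: The scalar field of $X$ is $\mathbb{R}$ or $\mathbb{C}$; $S_X$ is the unit sphere of $X$. $X$ has property $(sM)$ if whenever $x,y\in X$ satisfy $\|y\|\le\|x\|$, then $\limsup_\alpha\|y+x_\alpha\|\le\limsup_\alpha\|x+x_\alpha\|$ for every bounded weakly null net $(x_\alpha)\subset X$. $X$ is weak-net-stable if for any pair of bounded weakly null nets $(x_\alpha)$ and $(y_\beta)$ in $X$ one has $\lim_\alpha\lim_\beta\|x_\alpha+y_\beta\|=\lim_\beta\lim_\alpha\|x_\alpha+y_\beta\|$ whenever both sides exist. The moduli of asymptotic uniform convexity and smoothness are the functions on $[0,\infty)$ given by $\bar{\delta}_X(t)=\inf_{x\in S_X}\bar{\delta}_X(x,t)$ with $\bar{\delta}_X(x,t)=\sup_{\dim(X/Y)<\infty}\inf_{y\in Y,\|y\|\ge t}\|x+y\|-1$, and $\bar{\rho}_X(t)=\sup_{x\in S_X}\bar{\rho}_X(x,t)$ with $\bar{\rho}_X(x,t)=\inf_{\dim(X/Y)<\infty}\sup_{y\in Y,\|y\|\le t}\|x+y\|-1$, where $Y$ ranges over the closed subspaces of $X$ of finite codimension. For infinite dimensional $X$, $N^A_X$ is the norm on $\mathbb{R}^2$ given by $N^A_X(a,b)=|a|+|a|\,\bar{\rho}_X(|b/a|)$ if $a\ne 0$ and $N^A_X(0,b)=|b|$.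 A norm $N$ on $\mathbb{R}^2$ is symmetric if $N(a,b)=N(b,a)$ for every $(a,b)\in\mathbb{R}^2$. *)

(* Defs.v *)
From mathcomp Require Import all_boot all_order all_algebra.
From mathcomp Require Import complex.
From mathcomp Require Import all_classical all_reals all_analysis.

Set Implicit Arguments.
Unset Strict Implicit.
Unset Printing Implicit Defensive.

Import Order.TTheory GRing.Theory Num.Theory.
Import numFieldNormedType.Exports.
Local Open Scope classical_set_scope.
Local Open Scope ring_scope.

Inductive scalar_kind : Set := RealScalars | ComplexScalars.

Definition scalars (R : realType) (k : scalar_kind) : numFieldType :=
  match k with
  | RealScalars => R
  | ComplexScalars => R[i]
  end.

Definition real_part (R : realType) (k : scalar_kind) : scalars R k -> R :=
  match k return scalars R k -> R with
  | RealScalars => fun a => a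
  | ComplexScalars => fun a => complex.Re a
  end.

Definition directed_preorder (I : Type) (le : I -> I -> Prop) : Prop :=
  [/\ inhabited I,
      forall i, le i i,
      forall i j k, le i j -> le j k -> le i k &
      forall i j, exists k, le i k /\ le j k].

(* Limits of a net are taken along this filter of
   eventual sets. *)
Definition eventual_sets (I : Type) (le : I -> I -> Prop) : set_system I :=
  [set A | exists i, forall j, le i j -> A j].

Section BanachSpace.
Context (R : realType) (k : scalar_kind).
Local Notation K := (scalars R k).
Variable X : normedModType K.

(* MathComp-Analysis norms take their values in the scalar field. *)
Definition rnorm (x : X) : R := real_part `|x|.

Definition unit_sphere : set X := [set x | rnorm x = 1].

Definition infinite_dimensional : Prop :=
  ~ exists (n : nat) (v : 'I_n -> X),
      forall x, exists c : 'I_n -> K, x = \sum_(i < n) c i *: v i.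

(* The last clause says that the classes of v 0, ..., v (n - 1) span X / Y. *)
Definition closed_fincodim (Y : set X) : Prop :=
  [/\ GRing.submod_closed (mem Y),
      closed Y &
      exists (n : nat) (v : 'I_n -> X),
        forall x, exists c : 'I_n -> K, Y (x - \sum_(i < n) c i *: v i)].

Definition bounded_weakly_null_net
    (I : Type) (le : I -> I -> Prop) (x : I -> X) : Prop :=
  [/\ directed_preorder le,
      exists M : R, forall i, rnorm (x i) <= M &
      forall f : {linear X -> K^o}, continuous f ->
        (f \o x) @ eventual_sets le --> (0 : K^o)].

Definition net_limsup (I : Type) (le : I -> I -> Prop) (u : I -> R) : \bar R :=
  ereal_inf (range (fun i => ereal_sup [set (u j)%:E | j in le i])).

Definition property_sM : Prop :=
  forall x y : X, rnorm y <= rnorm x ->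
  forall (I : Type) (le : I -> I -> Prop) (z : I -> X),
    bounded_weakly_null_net le z ->
    (net_limsup le (fun i => rnorm (y + z i)%R) <=
     net_limsup le (fun i => rnorm (x + z i)%R))%E.

(* [iterated_lim leI leJ u l] means that lim_i lim_j u i j exists in R, all
   inner limits included, and equals l. *)
Definition iterated_lim (I J : Type) (leI : I -> I -> Prop)
    (leJ : J -> J -> Prop) (u : I -> J -> R) (l : R) : Prop :=
  exists g : I -> R,
    (forall i, u i @ eventual_sets leJ --> g i) /\
    g @ eventual_sets leI --> l.

Definition weak_net_stable : Prop :=
  forall (I J : Type) (leI : I -> I -> Prop) (leJ : J -> J -> Prop)
         (x : I -> X) (y : J -> X),
    bounded_weakly_null_net leI x -> bounded_weakly_null_net leJ y ->
  forall l m : R,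
    iterated_lim leI leJ (fun i j => rnorm (x i + y j)) l ->
    iterated_lim leJ leI (fun j i => rnorm (x i + y j)) m ->
    l = m.

(* The real-valued inf and sup below return 0 on sets that are empty or
   unbounded on the relevant side; this does not occur when X is infinite
   dimensional and 0 <= t. *)
Definition auc_modulus_at (x : X) (t : R) : R :=
  sup [set inf [set rnorm (x + y) | y in [set y | Y y /\ t <= rnorm y]]
      | Y in closed_fincodim] - 1.

Definition aus_modulus_at (x : X) (t : R) : R :=
  inf [set sup [set rnorm (x + y) | y in [set y | Y y /\ rnorm y <= t]]
      | Y in closed_fincodim] - 1.

Definition auc_modulus (t : R) : R :=
  inf [set auc_modulus_at x t | x in unit_sphere].

Definition aus_modulus (t : R) : R :=
  sup [set aus_modulus_at x t | x in unit_sphere].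

Definition NA (a b : R) : R :=
  if a == 0 then `|b| else `|a| + `|a| * aus_modulus `|b / a|.

End BanachSpace.

Arguments infinite_dimensional {R k} X.
Arguments property_sM {R k} X.
Arguments weak_net_stable {R k} X.
Arguments auc_modulus {R k} X t.
Arguments aus_modulus {R k} X t.
Arguments NA {R k} X a b.

(* Main.v *)
From HB Require Import structures.
Require Import Defs.
From mathcomp Require Import all_boot all_order all_algebra.
From mathcomp Require Import all_classical all_reals all_analysis.
From mathcomp Require Import complex ring lra.

(** Write [A(x,t)] and [B(x,t)] for [1 +] the pointwise moduli of asymptotic
    smoothness and convexity at [x].  Both are asymptotic quantities: for a
    suitable weakly null net of vectors [y] with [`|y| <= t], respectively
    [`|y| >= t], the norms [`|x + y|] tend to [A(x,t)], respectively to
    [B(x,t)].  All limits below are taken along ultrafilters, where bounded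
    real functions always converge; an ultrafilter finer than the eventual sets
    of a net plays the part of a subnet, and conversely every filter on [X] comes
    from a net ([filter_net_eventual]).

    If the moduli agree, then a weakly null net [z] with [`|z| -> s] is squeezed
    between them: [`|x + z|] tends to [N(`|x|, s)], where [N] is the norm [NA],
    for every [x] ([NA_limit]).  The limit depends only on [`|x|] and [s], and
    is nondecreasing in [`|x|] because [N] is symmetric and the smoothness
    modulus is nondecreasing; this is property (sM) ([equal_moduli_sM]).  An
    iterated limit of [`|x_i + y_j|] is [N(s,t)] or [N(t,s)] according to the
    order of the limits, and symmetry makes the two equal
    ([equal_moduli_weak_net_stable]).  The squeeze needs weakly null nets to
    approach every closed subspace of finite codimension.  This holds because
    such a subspace contains the range of [x |-> x - \sum_i f_i(x) u_i] for
    finitely many bounded functionals [f_i], the coordinates modulo the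
    subspace, and vectors [u_i] ([closed_fincodim_functionals]).

    Conversely, fix unit vectors [x], [x'] and [t > 0].  Take vectors [u] of
    norm at most [1] maximizing [`|t x' + u|] and vectors [v] of norm at least
    [t] minimizing [`|x + v|], both along subspaces of finite codimension.
    Property (sM) compares [u] with [x] and [v] with [t x']:
    [lim_v `|u + v| <= lim_v `|x + v| = B(x,t)] and
    [lim_u `|u + v| >= lim_u `|t x' + u| = t A(x', 1/t)].
    Weak-net-stability identifies the two iterated limits of [`|u + v|], so
    [t A(x', 1/t) <= B(x,t)] ([weak_net_stable_cross]).  The supremum over [x']
    turns the left side into [N(t,1) = N(1,t)], the supremum of [A(-,t)]; so
    the smoothness modulus is at most the convexity modulus, and the reverse
    inequality always holds. *)

Set Implicit Arguments.
Unset Strict Implicit.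
Unset Printing Implicit Defensive.

Import Order.TTheory GRing.Theory Num.Theory.
Import numFieldNormedType.Exports.
Local Open Scope classical_set_scope.
Local Open Scope ring_scope.

(** * Real-valued norms over real or complex scalars *)

Section ScalarField.
Context (R : realType) (k : scalar_kind).
Local Notation K := (scalars R k).

(** Section of [real_part]; it turns statements about the scalar-valued norm
    into statements about [rnorm], uniformly in the scalar field. *)
Definition of_real (a : R) : K :=
  match k return scalars R k with
  | RealScalars => a
  | ComplexScalars => a%:C%C
  end.

Lemma real_partK (c : K) : 0 <= c -> of_real (real_part c) = c.
Proof.
rewrite /of_real /real_part; case: k c => //= c c0.
exact/RRe_real/ger0_real.
Qed.

Lemma of_realK (a : R) : real_part (of_real a) = a.
Proof. by rewrite /of_real /real_part; case: k. Qed.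

Lemma of_realD (a b : R) : of_real (a + b) = of_real a + of_real b.
Proof. by rewrite /of_real; case: k => //=; rewrite rmorphD. Qed.

Lemma of_realM (a b : R) : of_real (a * b) = of_real a * of_real b.
Proof. by rewrite /of_real; case: k => //=; rewrite rmorphM. Qed.

Lemma of_realN (a : R) : of_real (- a) = - of_real a.
Proof. by rewrite /of_real; case: k => //=; rewrite rmorphN. Qed.

Lemma of_real0 : of_real 0 = 0.
Proof. by rewrite /of_real; case: k. Qed.

Lemma of_real1 : of_real 1 = 1.
Proof. by rewrite /of_real; case: k. Qed.

Lemma ler_of_real (a b : R) : (of_real a <= of_real b) = (a <= b).
Proof. by rewrite /of_real; case: k => //=; rewrite lecR. Qed.

Lemma ltr_of_real (a b : R) : (of_real a < of_real b) = (a < b).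
Proof. by rewrite /of_real; case: k => //=; rewrite ltcR. Qed.

Lemma norm_of_real (a : R) : `|of_real a| = of_real `|a|.
Proof.
rewrite /of_real; case: k => //=.
by rewrite normc_def /= expr0n /= addr0 sqrtr_sqr.
Qed.

End ScalarField.

Section RealNorm.
Context (R : realType) (k : scalar_kind).
Local Notation K := (scalars R k).
Local Notation toK := (@of_real R k).

Section OneSpace.
Variable X : normedModType K.
Implicit Types x y : X.

Lemma rnormE x : `|x| = toK (rnorm x).
Proof. by rewrite /rnorm real_partK. Qed.

Lemma rnorm_ge0 x : 0 <= rnorm x.
Proof. by rewrite -(@ler_of_real R k) -rnormE of_real0. Qed.

Lemma ler_rnormD x y : rnorm (x + y) <= rnorm x + rnorm y.
Proof. by rewrite -(@ler_of_real R k) of_realD -!rnormE ler_normD. Qed.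

Lemma rnormN x : rnorm (- x) = rnorm x.
Proof. by rewrite /rnorm normrN. Qed.

Lemma rnorm0 : rnorm (0 : X) = 0.
Proof. by rewrite /rnorm normr0 -(of_real0 R k) of_realK. Qed.

Lemma rnorm_eq0 x : rnorm x = 0 -> x = 0.
Proof. by move=> x0; apply/eqP; rewrite -normr_eq0 rnormE x0 of_real0. Qed.

Lemma rnormB x y : rnorm (x - y) = rnorm (y - x).
Proof. by rewrite -rnormN opprB. Qed.

Lemma ler_rnormB x y : rnorm x - rnorm y <= rnorm (x - y).
Proof. by rewrite lerBlDr; have := ler_rnormD (x - y) y; rewrite subrK. Qed.

Lemma ler_dist_rnorm x y : `|rnorm x - rnorm y| <= rnorm (x - y).
Proof.
rewrite ler_norml ler_rnormB andbT lerNl opprB rnormB; exact: ler_rnormB.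
Qed.

Lemma rnormZr (a : R) x : rnorm (toK a *: x) = `|a| * rnorm x.
Proof.
by apply: (can_inj (@of_realK R k)); rewrite -rnormE normrZ of_realM -norm_of_real -rnormE.
Qed.

Lemma nbhs_rnormP x (A : set X) : nbhs x A <->
  exists2 e : R, 0 < e & forall y, rnorm (x - y) < e -> A y.
Proof.
split=> [/nbhs_normP[e /= e0 eA]|[e e0 eA]].
  exists (real_part e).
    by rewrite -(@ltr_of_real R k) of_real0 real_partK // ltW.
  move=> y xy; apply: eA => /=; rewrite rnormE -(@real_partK R k e) ?ltW//.
  by rewrite ltr_of_real.
apply/nbhs_normP; exists (toK e) => /=; first by rewrite -(of_real0 R k) ltr_of_real.
by move=> y /=; rewrite rnormE ltr_of_real => /eA.
Qed.

Lemma cvg_rnormP (T : Type) (F : set_system T) (FF : Filter F) (z : T -> X) x :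
  z @ F --> x <-> forall e : R, 0 < e -> F [set t | rnorm (x - z t) < e].
Proof.
split=> [zx e e0|zx A /nbhs_rnormP[e e0 eA]].
  by apply: (zx [set y | rnorm (x - y) < e]); apply/nbhs_rnormP; exists e.
exact: (@filterS _ F FF _ _ (fun t => eA (z t)) (zx e e0)).
Qed.

End OneSpace.

Lemma rnormZ (X : normedModType K) (c : K) (x : X) :
  rnorm (c *: x) = rnorm (c : K^o) * rnorm x.
Proof.
by apply: (can_inj (@of_realK R k)); rewrite -rnormE normrZ of_realM -!rnormE.
Qed.

Lemma rnorm_of_real (a : R) : rnorm (toK a : K^o) = `|a|.
Proof. by rewrite /rnorm norm_of_real of_realK. Qed.

Lemma rnorm_scalar_neq0 (c : K) : c != 0 -> rnorm (c : K^o) != 0.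
Proof. by apply: contra => /eqP/rnorm_eq0 ->. Qed.

Lemma rnormV (c : K) : c != 0 -> rnorm (c^-1 : K^o) = (rnorm (c : K^o))^-1.
Proof.
move=> c0; apply: (mulfI (rnorm_scalar_neq0 c0)).
rewrite divff ?rnorm_scalar_neq0// -rnormZ /GRing.scale/= divff//.
by rewrite -(of_real1 R k) rnorm_of_real normr1.
Qed.

End RealNorm.

(** * Ultrafilters *)

Section Ultrafilters.

Lemma ultra_of_base (T I : Type) (D : I -> set T) :
  inhabited I -> (forall i, D i !=set0) ->
  (forall i j, exists l, D l `<=` D i `&` D j) ->
  exists U : set_system T, UltraFilter U /\ forall i, U (D i).
Proof.
move=> [i0] D0 DI.
have PF : ProperFilter (filter_from setT D).
  apply: filter_from_proper; last by move=> i _; exact: D0.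
  apply: filter_from_filter; first by exists i0.
  by move=> i j _ _; have [l Dl] := DI i j; exists l.
have [U [UU FU]] := ultraFilterLemma PF.
by exists U; split=> // i; apply: FU; exists i.
Qed.

(** An ultrafilter converges to each of its cluster points, and segments are
    compact. *)
Lemma ultra_bounded_cvg (R : realType) (T : Type) (U : set_system T)
    (UU : UltraFilter U) (phi : T -> R) (M : R) :
  U [set t | `|phi t| <= M] -> exists l : R, phi @ U --> l.
Proof.
move=> UM; have [|l [_ Ul]] := @segment_compact R (- M) M (phi @ U) _.
  by apply: (@filterS _ U _ _ _ _ UM) => t; rewrite /= in_itv /= -ler_norml.
exists l => A lA.
have [//|UA] := in_ultra_setVsetC (phi @^-1` A) UU.
by have [r []] := Ul (~` A) A UA lA.
Qed.

(** The scalar field is locally compact; for complex scalars the real and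
    imaginary parts are treated separately. *)
Lemma ultra_scalar_cvg (R : realType) (k : scalar_kind) (T : Type)
    (U : set_system T) (UU : UltraFilter U) (c : T -> scalars R k) (M : R) :
  U [set t | rnorm (c t : (scalars R k)^o) <= M] ->
  exists c0 : (scalars R k)^o, (c : T -> (scalars R k)^o) @ U --> c0.
Proof.
case: k c => c UM.
  by have [l Ul] := ultra_bounded_cvg UU UM; exists l.
have rnormC (z : R[i]) : rnorm (z : (scalars R ComplexScalars)^o) =
    Num.sqrt (complex.Re z ^+ 2 + complex.Im z ^+ 2).
  by transitivity (complex.Re (`|z| : R[i])); [|rewrite normc_def].
have ReM (z : R[i]) : `|complex.Re z| <= rnorm (z : (scalars R ComplexScalars)^o).
  by rewrite rnormC -sqrtr_sqr; apply: ler_wsqrtr; rewrite lerDl sqr_ge0.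
have ImM (z : R[i]) : `|complex.Im z| <= rnorm (z : (scalars R ComplexScalars)^o).
  by rewrite rnormC -sqrtr_sqr; apply: ler_wsqrtr; rewrite lerDr sqr_ge0.
have [|a Ua] := @ultra_bounded_cvg R T U UU (@complex.Re R \o c) M.
  by move: UM; apply: filterS => t /=; exact: le_trans.
have [|b Ub] := @ultra_bounded_cvg R T U UU (@complex.Im R \o c) M.
  by move: UM; apply: filterS => t /=; exact: le_trans.
have rnorm_le (z : R[i]) : rnorm (z : (scalars R ComplexScalars)^o) <=
    `|complex.Re z| + `|complex.Im z|.
  rewrite rnormC -[leRHS]ger0_norm ?addr_ge0// -sqrtr_sqr; apply: ler_wsqrtr.
  by rewrite sqrrD !real_normK ?num_real// lerD2r lerDl mulrn_wge0// mulr_ge0.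
exists (a +i* b)%C; apply/(@cvg_rnormP R ComplexScalars) => e e0.
have e20 : 0 < e / 2 by rewrite divr_gt0.
move/cvgrPdist_lt : Ua => /(_ _ e20) Ua; move/cvgrPdist_lt : Ub => /(_ _ e20) Ub.
move: Ua Ub; apply: filterS2 => t ta tb.
apply: le_lt_trans (rnorm_le _) _; move: ta tb => /=.
by case: (c t) => u v /= ta tb; lra.
Qed.

End Ultrafilters.

(** * Closed subspaces of finite codimension *)

Section FiniteCodimension.
Context (R : realType) (k : scalar_kind).
Local Notation K := (scalars R k).
Variable X : normedModType K.
Implicit Types (x y w : X) (Y Z : set X).

Definition subspace Y := Y 0 /\ forall (c : K) x y, Y x -> Y y -> Y (c *: x + y).

Lemma subspaceP Y : GRing.submod_closed (mem Y) <-> subspace Y.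
Proof.
split=> -[Y0 YZ]; split.
- exact: set_mem.
- by move=> c x y /mem_set Yx /mem_set Yy; apply/set_mem/YZ.
- exact: mem_set.
- by move=> c x y /set_mem Yx /set_mem Yy; apply/mem_set/YZ.
Qed.

Section Subspace.
Variable Y : set X.
Hypothesis sY : subspace Y.

Lemma subspaceD x y : Y x -> Y y -> Y (x + y).
Proof. by move=> Yx Yy; rewrite -(scale1r x); apply: sY.2. Qed.

Lemma subspaceZ c x : Y x -> Y (c *: x).
Proof. by move=> Yx; rewrite -(addr0 (c *: x)); apply: sY.2 => //; exact: sY.1. Qed.

Lemma subspaceB x y : Y x -> Y y -> Y (x - y).
Proof. by move=> Yx Yy; rewrite -scaleN1r; apply: subspaceD => //; exact: subspaceZ. Qed.

(** The ball of radius [d] about [w] misses [Y]: if [x = c w] modulo [Y]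
    and [c] is nonzero, then [c^-1 x] differs from [w] by an element of [Y].
    This makes the coordinate along [w] of a vector of [Y + K w] a bounded
    function. *)
Lemma subspace_coord_le w : closed Y -> ~ Y w ->
  exists2 d : R, 0 < d &
    forall (c : K) x, Y (x - c *: w) -> rnorm (c : K^o) * d <= rnorm x.
Proof.
move=> cY Yw.
have /nbhs_rnormP[d d0 dY] : nbhs w (~` Y).
  by apply: open_nbhs_nbhs; split => //; exact: closed_openC.
exists d => // c x Yx.
have [->|c0] := eqVneq c 0; first by rewrite (@rnorm0 R k) mul0r rnorm_ge0.
rewrite mulrC -ler_pdivlMr; last by rewrite lt0r rnorm_scalar_neq0 ?rnorm_ge0.
rewrite mulrC -(rnormV c0) -rnormZ leNgt; apply/negP => xd.
apply: (dY (w - c^-1 *: x)); first by rewrite opprB addrC subrK.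
have -> : w - c^-1 *: x = - c^-1 *: (x - c *: w).
  by rewrite scalerBr !scaleNr scalerA mulVf// scale1r opprK addrC.
exact: subspaceZ.
Qed.

(** Let [p] be a limit of points of [Y + K w].  By [subspace_coord_le] their
    coordinates along [w] stay bounded, so they converge along an ultrafilter
    to some [c0]; then [p - c0 w] is a limit of points of [Y]. *)
Lemma closed_add_line w : closed Y -> ~ Y w ->
  closed [set x | exists c : K, Y (x - c *: w)].
Proof.
move=> cY Yw; have [d d0 dY] := subspace_coord_le cY Yw.
move=> p pY'.
(* Coordinates along [w] of points of [Y + K w] close to [p]. *)
pose D (e : {posnum R}) :=
  [set c : K | exists2 x, Y (x - c *: w) & rnorm (p - x) < e%:num].
have [||U [UU UD]] := @ultra_of_base K {posnum R} D (inhabits 1%:pos).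
- move=> e; have [|x [[c Yx] px]] := pY' [set x | rnorm (p - x) < e%:num].
    by apply/nbhs_rnormP; exists e%:num.
  by exists c, x.
- move=> a b; exists (Order.min a%:num b%:num)%:pos => c [x Yx px]; split; exists x => //.
    by rewrite (lt_le_trans px)//= ge_min lexx.
  by rewrite (lt_le_trans px)//= ge_min lexx orbT.
have [|c0 Uc] := @ultra_scalar_cvg R k K U UU id ((rnorm p + 1) / d).
  have := UD (PosNum ltr01); apply: filterS => c [x Yx px] /=.
  rewrite ler_pdivlMr//; apply: le_trans (dY _ _ Yx) _.
  have := ler_rnormB x p; rewrite rnormB; move: px => /=; lra.
exists c0; apply: cY => A /nbhs_rnormP[e e0 eA].
have w1 : 0 < rnorm w + 1 by have := rnorm_ge0 w; lra.
have f0 : 0 < e / (rnorm w + 1 + 1) by rewrite divr_gt0//; lra.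
set f := e / _ in f0.
move/cvg_rnormP : Uc => /(_ f f0) Uc.
have [c [cc0 [x Yx px]]] := filter_ex (@filterI _ U _ _ _ Uc (UD (PosNum f0))).
exists (x - c *: w); split => //; apply: eA.
have -> : p - c0 *: w - (x - c *: w) = (p - x) + - (c0 - c) *: w.
  by rewrite scaleNr scalerBl (opprB (c0 *: w)) opprD opprK addrACA (addrC (c *: w)).
apply: le_lt_trans (ler_rnormD _ _) _.
rewrite rnormZ (@rnormN R k).
have ef : e = f + rnorm w * f + f by rewrite /f; field; apply: lt0r_neq0; lra.
rewrite ef -addrA; apply: ltr_leD; first exact: px.
rewrite [X in X <= _]mulrC ler_wpDr ?(ltW f0)//; apply: ler_wpM2l; first exact: rnorm_ge0.
exact: ltW.
Qed.

End Subspace.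

Definition bounded_functional : Type :=
  {f : {linear X -> K^o} | exists C : R, forall x, rnorm (f x) <= C * rnorm x}.

Lemma bounded_functional_continuous (f : bounded_functional) : continuous (sval f).
Proof.
case: f => f /= [C fC] x; apply/cvg_rnormP => e e0.
apply/nbhs_rnormP; exists (e / (`|C| + 1)).
  by rewrite divr_gt0// ltr_wpDl.
move=> y; rewrite /= ltr_pdivlMr ?ltr_wpDl// -raddfB => xy.
apply: le_lt_trans (fC _) (le_lt_trans _ xy); rewrite [leRHS]mulrC.
by apply: ler_wpM2r; [exact: rnorm_ge0 | have := ler_norm C; lra].
Qed.

End FiniteCodimension.

Arguments bounded_functional_continuous {R k X} f.

Section ClosedFiniteCodimension.
Context (R : realType) (k : scalar_kind).
Local Notation K := (scalars R k).
Local Notation toK := (@of_real R k).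
Variable X : normedModType K.
Implicit Types (x y w : X) (Y Z : set X).
Local Notation bounded_functional := (bounded_functional X).

Lemma bounded_functional_sum (s : seq (bounded_functional * X)) :
  exists C : R, forall x,
    rnorm (\sum_(p <- s) (sval p.1 x : K) *: p.2) <= C * rnorm x.
Proof.
elim: s => [|[[f /= [C fC]] u] s [D IH]].
  by exists 0 => x; rewrite big_nil rnorm0 mul0r.
exists (C * rnorm u + D) => x; rewrite big_cons mulrDl.
apply: le_trans (ler_rnormD _ _) (lerD _ (IH x)).
by rewrite rnormZ mulrAC; apply: ler_wpM2r; [exact: rnorm_ge0|exact: fC].
Qed.

Lemma bounded_functional_sum_linear (s : seq (bounded_functional * X)) (a : K) x y :
  \sum_(p <- s) (sval p.1 (a *: x + y) : K) *: p.2 =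
  a *: (\sum_(p <- s) (sval p.1 x : K) *: p.2) +
  \sum_(p <- s) (sval p.1 y : K) *: p.2.
Proof.
rewrite scaler_sumr -big_split; apply: eq_bigr => p _ /=.
by rewrite linearP scalerDl scalerA.
Qed.

(** Induction on the size of the spanning family modulo [Y].  If its last
    vector [w] is not in [Y], then [Y + K w] is closed and the induction
    hypothesis maps [X] into it; the coordinate along [w] of the image is the
    additional bounded functional. *)
Lemma spanning_complement_functionals n Y (v : 'I_n -> X) :
  subspace Y -> closed Y ->
  (forall x, exists c : 'I_n -> K, Y (x - \sum_(i < n) c i *: v i)) ->
  exists s : seq (bounded_functional * X),
    forall x, Y (x - \sum_(p <- s) (sval p.1 x : K) *: p.2).
Proof.
elim: n Y v => [|n IH] Y v sY cY Yv.
  by exists [::] => x; rewrite big_nil; have [c] := Yv x; rewrite big_ord0.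
set w := v ord_max; set v' := fun i => v (widen_ord (leqnSn n) i).
have [Yw|Yw] := pselect (Y w).
  apply: (IH Y v') => // x; have [c] := Yv x; rewrite big_ord_recr /= => Yx.
  exists (fun i => c (widen_ord (leqnSn n) i)).
  by have := subspaceD sY Yx (subspaceZ sY (c ord_max) Yw); rewrite opprD addrA subrK.
pose Y' := [set x | exists c : K, Y (x - c *: w)].
have sY' : subspace Y'.
  split=> [|a x y [c Yx] [d Yy]]; first by exists 0; rewrite scale0r subr0; exact: sY.1.
  exists (a * c + d); rewrite scalerDl -scalerA opprD addrACA -scalerBr.
  exact: sY.2.
have [|s Ys] := IH Y' v' sY' (closed_add_line sY cY Yw).
  move=> x; have [c] := Yv x; rewrite big_ord_recr /= opprD addrA => Yx.
  by exists (fun i => c (widen_ord (leqnSn n) i)), (c ord_max).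
have [g Yg] := choice Ys; set S := fun x => \sum_(p <- s) (sval p.1 x : K) *: p.2.
have [d d0 dY] := subspace_coord_le sY cY Yw.
(* As [w] is not in [Y], coordinates along [w] are unique, whence the
   linearity of [g]. *)
have g_uniq x c : Y (x - S x - c *: w) -> g x = c.
  move=> Yc; have : Y (0 - (c - g x) *: w).
    have -> : 0 - (c - g x) *: w = (x - S x - c *: w) - (x - S x - g x *: w).
      by rewrite sub0r -scaleNr opprB scalerBl [in RHS]opprB [RHS]addrC addrA subrK.
    exact: subspaceB.
  move=> /dY; rewrite rnorm0 => g0; apply/eqP; rewrite eq_sym -subr_eq0; apply/eqP.
  by apply: (@rnorm_eq0 R k K^o); have := rnorm_ge0 (c - g x : K^o); nra.
have glin : linear (g : X -> K^o).
  move=> a x y; apply: g_uniq; rewrite /S bounded_functional_sum_linear -/(S x) -/(S y).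
  rewrite scalerDl -scalerA opprD addrACA -scalerBr opprD addrACA -scalerBr.
  exact: sY.2.
have [C SC] := bounded_functional_sum s.
pose gL : {linear X -> K^o} := HB.pack (g : X -> K^o)
  (GRing.isLinear.Build _ _ _ _ (g : X -> K^o) glin).
have gB : exists C : R, forall x, rnorm (gL x) <= C * rnorm x.
  exists ((1 + C) / d) => x; rewrite mulrAC ler_pdivlMr//.
  apply: le_trans (dY _ _ (Yg x)) _; rewrite mulrDl mul1r.
  by apply: le_trans (ler_rnormD _ _) _; rewrite rnormN lerD2l.
exists ((exist _ gL gB, w) :: s) => x; rewrite big_cons /= opprD addrCA addrC.
exact: Yg.
Qed.

Lemma closed_fincodim_functionals Y : closed_fincodim Y ->
  exists s : seq (bounded_functional * X),
    forall x, Y (x - \sum_(p <- s) (sval p.1 x : K) *: p.2).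
Proof.
case=> /subspaceP sY cY [n [v Yv]]; exact: spanning_complement_functionals Yv.
Qed.

Lemma closed_fincodimT : closed_fincodim [set: X].
Proof.
split; [by apply/subspaceP | exact: closedT |].
by exists 0%N, (fun=> 0) => x; exists (fun=> 0).
Qed.

Lemma closed_fincodim_ker Y (f : {linear X -> K^o}) : continuous f ->
  closed_fincodim Y -> closed_fincodim (Y `&` [set x | f x = 0]).
Proof.
move=> cf [/subspaceP sY cY [n [v Yv]]]; split.
- apply/subspaceP; split=> [|a x y [Yx fx] [Yy fy]].
    by split; [exact: sY.1|exact: linear0].
  by split; [exact: sY.2|rewrite /= linearP fx fy scaler0 addr0].
- apply: closedI => //; apply: (@preimage_closed _ _ f [set 0]) => //.
  exact: accessible_closed_set1 (hausdorff_accessible (@norm_hausdorff K K^o)) _.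
- have [Yf|/existsNP[u /not_implyP[Yu fu]]] := pselect (forall y, Y y -> f y = 0).
    by exists n, v => x; have [c Yx] := Yv x; exists c; split=> //; exact: Yf.
  have {}fu : f u != 0 by apply/eqP.
  (* A vector [u] of [Y] outside the kernel completes the spanning family. *)
  exists n.+1, (fun i => oapp v u (unlift ord_max i)) => x.
  have [c Yx] := Yv x; set y := x - _ in Yx.
  exists (fun i => oapp c (f y / f u) (unlift ord_max i)).
  rewrite big_ord_recr /= unlift_none /=.
  rewrite (eq_bigr (fun i => c i *: v i)) => [|i _]; last first.
    have -> : widen_ord (leqnSn n) i = lift ord_max i.
      by apply/val_inj; rewrite /= /bump leqNgt ltn_ord.
    by rewrite liftK.
  rewrite opprD addrA -/y; split; first exact: (subspaceB sY Yx (subspaceZ sY _ Yu)).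
  by rewrite /= linearB linearZ /= [_ *: _]divfK// subrr.
Qed.

(** [Y2] contains the common kernel of finitely many functionals, and cutting
    [Y1] with one kernel adds at most one vector to a spanning complement. *)
Lemma closed_fincodim_directed Y1 Y2 : closed_fincodim Y1 -> closed_fincodim Y2 ->
  exists2 Z, closed_fincodim Z & Z `<=` Y1 `&` Y2.
Proof.
move=> Y1f /closed_fincodim_functionals[s Y2s].
suff [Z Zf [ZY Zs]] : exists2 Z, closed_fincodim Z & Z `<=` Y1 /\
    forall x, Z x -> \sum_(p <- s) (sval p.1 x : K) *: p.2 = 0.
  by exists Z => // x Zx; split; [exact: ZY|have := Y2s x; rewrite Zs// subr0].
elim: s {Y2s} => [|[f u] s [Z Zf [ZY Zs]]].
  by exists Y1 => //; split=> // x _; rewrite big_nil.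
have cf := bounded_functional_continuous f.
exists (Z `&` [set x | sval f x = 0]); first exact: closed_fincodim_ker.
split=> x [Zx fx]; first exact: ZY.
by rewrite big_cons /= Zs// addr0 [sval f x]fx scale0r.
Qed.

Definition weakly_null (T : Type) (F : set_system T) (z : T -> X) :=
  forall f : {linear X -> K^o}, continuous f -> (f \o z) @ F --> (0 : K^o).

(** Subtracting [\sum_i f_i(z) u_i] moves [z] into [Y], and the coefficients
    [f_i(z)] tend to zero. *)
Lemma weakly_null_near_fincodim (T : Type) (F : set_system T) (FF : Filter F)
    (z : T -> X) Y (e : R) : weakly_null F z -> closed_fincodim Y -> 0 < e ->
  F [set t | exists2 y, Y y & rnorm (z t - y) < e].
Proof.
move=> wz /closed_fincodim_functionals[s Ys] e0.
suff : F [set t | rnorm (\sum_(p <- s) (sval p.1 (z t) : K) *: p.2) < e].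
  apply: filterS => t te; exists (z t - \sum_(p <- s) (sval p.1 (z t) : K) *: p.2) => //.
  by rewrite opprB addrC subrK.
elim: s {Ys} e e0 => [|[f u] s IH] e e0.
  by apply: filterE => t; rewrite /= big_nil rnorm0.
have u0 : 0 < rnorm u + 1 by have := rnorm_ge0 u; lra.
have fu0 : 0 < e / 2 / (rnorm u + 1) by rewrite !divr_gt0.
have /cvg_rnormP/(_ _ fu0) := wz _ (bounded_functional_continuous f).
have e20 : 0 < e / 2 by rewrite divr_gt0.
move: (IH _ e20); apply: filterS2 => t ts tf.
rewrite /= big_cons; apply: le_lt_trans (ler_rnormD _ _) _.
move: tf ts; rewrite /= sub0r rnormN rnormZ ltr_pdivlMr// mulrDr mulr1 => tf ts.
by have := rnorm_ge0 (sval f (z t)); lra.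
Qed.

Lemma weakly_null_fine (T : Type) (F G : set_system T) (z : T -> X) :
  F `<=` G -> weakly_null F z -> weakly_null G z.
Proof. by move=> FG wz f cf A /(wz f cf); exact: FG. Qed.

Lemma weakly_nullZ (T : Type) (F : set_system T) (FF : Filter F) (z : T -> X) (c : K) :
  weakly_null F z -> weakly_null F (fun t => c *: z t).
Proof.
move=> wz f cf; apply/cvg_rnormP => e e0.
have c1 : 0 < rnorm (c : K^o) + 1 by have := rnorm_ge0 (c : K^o); lra.
have ec : 0 < e / (rnorm (c : K^o) + 1) by rewrite divr_gt0.
have /cvg_rnormP/(_ _ ec) := wz f cf; apply: filterS => t /=.
rewrite !sub0r !rnormN linearZ ltr_pdivlMr// => ft.
apply: le_lt_trans ft; rewrite rnormZ mulrC.
by apply: ler_wpM2l; [exact: rnorm_ge0|rewrite lerDl].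
Qed.

Lemma ultra_rnorm_cvg (T : Type) (U : set_system T) (UU : UltraFilter U)
    (z : T -> X) (M : R) : U [set t | rnorm (z t) <= M] ->
  exists2 s : R, 0 <= s & (fun t => rnorm (z t)) @ U --> s.
Proof.
move=> UM; have [|s zs] := @ultra_bounded_cvg R T U UU (fun t => rnorm (z t)) M.
  by move: UM; apply: filterS => t /=; rewrite ger0_norm// rnorm_ge0.
exists s => //; apply: (cvgr_to_ge zs); apply: filterE => t; exact: rnorm_ge0.
Qed.

Section InfiniteDimension.
Hypothesis Xinf : infinite_dimensional X.

Lemma fincodim_sphere Y (r : R) : closed_fincodim Y -> 0 <= r ->
  exists2 y, Y y & rnorm y = r.
Proof.
move=> [/subspaceP sY _ [n [v Yv]]] r0.
have [y Yy y0] : exists2 y, Y y & y <> 0.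
  apply: contrapT => nY; apply: Xinf; exists n, v => x; have [c Yx] := Yv x; exists c.
  apply/eqP; rewrite -subr_eq0; apply/eqP; apply: contrapT => nx; apply: nY.
  by eexists; [exact: Yx|].
have y1 : rnorm y != 0 by apply/eqP => /rnorm_eq0.
exists (toK (r / rnorm y) *: y); first exact: (subspaceZ sY).
by rewrite rnormZr ger0_norm ?divr_ge0 ?rnorm_ge0// divfK.
Qed.

(** Rescaling [y] does this; the zero vector, which cannot be rescaled, is
    replaced by any vector of norm [r] in [Y]. *)
Lemma fincodim_renorm Y y (r : R) : closed_fincodim Y -> Y y -> 0 <= r ->
  exists2 y', Y y' & rnorm y' = r /\ rnorm (y - y') = `|rnorm y - r|.
Proof.
move=> fY Yy r0; have sY : subspace Y by case: fY => /subspaceP.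
have [/eqP/rnorm_eq0 ->|y0] := boolP (rnorm y == 0).
  have [y' Yy' y'r] := fincodim_sphere fY r0.
  by exists y' => //; rewrite sub0r rnormN rnorm0 sub0r normrN ger0_norm.
exists (toK (r / rnorm y) *: y); first exact: (subspaceZ sY).
split; first by rewrite rnormZr ger0_norm ?divr_ge0 ?rnorm_ge0// divfK.
rewrite -{1}(scale1r y) -scalerBl -(of_real1 R k) -of_realN -of_realD rnormZr.
by rewrite -{2}[rnorm y]ger0_norm ?rnorm_ge0// -normrM mulrBl divfK// mul1r.
Qed.

End InfiniteDimension.
End ClosedFiniteCodimension.

Arguments closed_fincodimT {R k} X.

(** * Nets and filters *)

Lemma eventual_filter (I : Type) (le : I -> I -> Prop) :
  directed_preorder le -> ProperFilter (eventual_sets le).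
Proof.
move=> [[i0] refl trans dir]; apply: Build_ProperFilter_ex.
  by move=> A [i iA]; exists i; exact: iA.
split; first by exists i0.
- move=> A B [i iA] [j jB]; have [l [il jl]] := dir i j.
  by exists l => m lm; split; [apply: iA; exact: trans lm|apply: jB; exact: trans lm].
- by move=> A B AB [i iA]; exists i => j /iA /AB.
Qed.

Section FilterNet.
Context (T : Type) (F : set_system T) (FF : ProperFilter F) (B : set T).
Hypothesis FB : F B.

(** The points of the net range over [B], so that a bound which holds on a set
    of the filter holds for all terms of the net. *)
Definition filter_net_index : Type :=
  {p : set T * T | [/\ F p.1, p.1 p.2 & B p.2]}.

Definition filter_net_le (p q : filter_net_index) : Prop :=
  (sval q).1 `<=` (sval p).1.

Definition filter_net (p : filter_net_index) : T := (sval p).2.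

Lemma filter_net_ex A : F A -> exists p : filter_net_index, (sval p).1 = A.
Proof.
move=> FA; have [t [At Bt]] := filter_ex (filterI FA FB).
have pP : [/\ F (A, t).1, (A, t).1 (A, t).2 & B (A, t).2] by [].
by exists (exist _ (A, t) pP).
Qed.

Lemma filter_net_directed : directed_preorder filter_net_le.
Proof.
split.
- by have [p _] := filter_net_ex filterT; exact: inhabits p.
- by move=> p.
- by move=> p q r pq qr t /qr /pq.
- move=> p q; have [Fp _ _] := svalP p; have [Fq _ _] := svalP q.
  have [r rE] := filter_net_ex (filterI Fp Fq).
  by exists r; split; rewrite /filter_net_le rE => t [].
Qed.

Lemma filter_net_eventual A : F A ->
  eventual_sets filter_net_le [set p | A (filter_net p)].
Proof.
move=> FA; have [p pE] := filter_net_ex FA; exists p => q pq.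
by rewrite /= -pE; apply: pq; have [] := svalP q.
Qed.

Lemma filter_net_cvg (V : topologicalType) (phi : T -> V) (l : V) :
  phi @ F --> l -> (phi \o filter_net) @ eventual_sets filter_net_le --> l.
Proof. by move=> Fl A /Fl; exact: filter_net_eventual. Qed.

End FilterNet.

Section NetLimsup.
Context (R : realType) (I : Type) (le : I -> I -> Prop).
Hypothesis dle : directed_preorder le.
Variables (u : I -> R) (c : R).

Lemma net_limsup_ge : eventual_sets le [set i | c <= u i] ->
  (c%:E <= net_limsup le u)%E.
Proof.
move=> [i0 ci0]; apply: le_ereal_inf_tmp => _ [i _ <-].
case: dle => _ _ _ dir; have [j [ij i0j]] := dir i i0.
apply: (@le_trans _ _ (u j)%:E); first by rewrite lee_fin; exact: ci0.
by apply: ereal_sup_ubound; exists j.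
Qed.

Lemma net_limsup_le : eventual_sets le [set i | u i <= c] ->
  (net_limsup le u <= c%:E)%E.
Proof.
move=> [i ci]; apply: (@le_trans _ _ (ereal_sup [set (u j)%:E | j in le i])).
  by apply: ereal_inf_lbound; exists i.
by apply: ge_ereal_sup => _ [j ij <-]; rewrite lee_fin; exact: ci.
Qed.

End NetLimsup.

Section RealLimits.
Context (R : realType) (T : Type) (F : set_system T) (FF : ProperFilter F).

Lemma limit_le (u v : T -> R) (a b : R) :
  u @ F --> a -> v @ F --> b -> F [set t | u t <= v t] -> a <= b.
Proof.
move=> ua vb uv; rewrite -subr_ge0; apply: (cvgr_to_ge (cvgB vb ua)).
by move: uv; apply: filterS => t /=; rewrite subr_ge0.
Qed.

Lemma limit_unique (u : T -> R) (a b : R) : u @ F --> a -> u @ F --> b -> a = b.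
Proof. exact: cvg_unique. Qed.

End RealLimits.

(** * The asymptotic moduli *)

Section Moduli.
Context (R : realType) (k : scalar_kind).
Local Notation K := (scalars R k).
Variable X : normedModType K.
Hypothesis Xinf : infinite_dimensional X.
Implicit Types (x y : X) (Y : set X).

Lemma infinite_dimensional_sphere : exists x, unit_sphere x.
Proof.
have [x _ x1] := fincodim_sphere Xinf (closed_fincodimT X) ler01.
by exists x.
Qed.

Section AtPoint.
Variables (x : X) (t : R).
Hypothesis t0 : 0 <= t.

Let outer Y := [set rnorm (x + y) | y in [set y | Y y /\ rnorm y <= t]].
Let inner Y := [set rnorm (x + y) | y in [set y | Y y /\ t <= rnorm y]].

Let outer_sup Y : closed_fincodim Y -> has_sup (outer Y).
Proof.
case=> /subspaceP sY _ _; split.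
  by exists (rnorm (x + 0)), 0 => //; split; [exact: sY.1|rewrite rnorm0].
by exists (rnorm x + t) => _ [y [_ yt] <-]; apply: le_trans (ler_rnormD _ _) _; rewrite lerD2l.
Qed.

Let outer_sup_ge Y : closed_fincodim Y -> rnorm x <= sup (outer Y).
Proof.
move=> fY; apply: sup_upper_bound; first exact: outer_sup.
case: fY => /subspaceP sY _ _.
by exists 0; [split; [exact: sY.1|rewrite rnorm0]|rewrite addr0].
Qed.

Let outer_inf : has_inf [set sup (outer Y) | Y in @closed_fincodim R k X].
Proof.
split; first by exists (sup (outer setT)), setT => //; exact: closed_fincodimT.
by exists (rnorm x) => _ [Y fY <-]; exact: outer_sup_ge.
Qed.

Let inner_inf Y : closed_fincodim Y -> has_inf (inner Y).
Proof.
move=> fY; have [y Yy yt] := fincodim_sphere Xinf fY t0; split.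
  by exists (rnorm (x + y)), y => //; split=> //; rewrite yt.
by exists 0 => _ [y' _ <-]; exact: rnorm_ge0.
Qed.

Let inner_sup : has_sup [set inf (inner Y) | Y in @closed_fincodim R k X].
Proof.
split; first by exists (inf (inner setT)), setT => //; exact: closed_fincodimT.
exists (rnorm x + t) => _ [Y fY <-].
have [y Yy yt] := fincodim_sphere Xinf fY t0.
apply: (@le_trans _ _ (rnorm (x + y))); last by rewrite -yt ler_rnormD.
by apply: ge_inf; [exact: (inner_inf fY).2|exists y => //; split=> //; rewrite yt].
Qed.

(** The four lemmas [aus_modulus_at_near], [aus_modulus_at_attained],
    [auc_modulus_at_near] and [auc_modulus_at_attained] characterize the
    pointwise moduli by approximation, and replace the real suprema and infima
    of their definitions in what follows. *)
Lemma aus_modulus_at_near (e : R) : 0 < e -> exists2 Y, closed_fincodim Y &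
  forall y, Y y -> rnorm y <= t -> rnorm (x + y) < 1 + aus_modulus_at x t + e.
Proof.
move=> e0; have [_ [Y fY <-] Ye] := inf_adherent e0 outer_inf.
exists Y => // y Yy yt; rewrite /aus_modulus_at addrCA subrr addr0.
by apply: le_lt_trans Ye; apply: sup_upper_bound; [exact: outer_sup|exists y].
Qed.

Lemma aus_modulus_at_attained Y (e : R) : closed_fincodim Y -> 0 < e ->
  exists y, [/\ Y y, rnorm y <= t & 1 + aus_modulus_at x t - e < rnorm (x + y)].
Proof.
move=> fY e0; have [_ [y [Yy yt] <-] Ye] := sup_adherent e0 (outer_sup fY).
exists y; split=> //; apply: le_lt_trans Ye.
rewrite lerD2r /aus_modulus_at addrCA subrr addr0.
by apply: ge_inf; [exact: outer_inf.2|exists Y].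
Qed.

Lemma auc_modulus_at_near (e : R) : 0 < e -> exists2 Y, closed_fincodim Y &
  forall y, Y y -> t <= rnorm y -> 1 + auc_modulus_at x t - e < rnorm (x + y).
Proof.
move=> e0; have [_ [Y fY <-] Ye] := sup_adherent e0 inner_sup.
exists Y => // y Yy yt; rewrite /auc_modulus_at [1 + _]addrCA subrr addr0.
by apply: lt_le_trans Ye _; apply: ge_inf; [exact: (inner_inf fY).2|exists y].
Qed.

Lemma auc_modulus_at_attained Y (e : R) : closed_fincodim Y -> 0 < e ->
  exists y, [/\ Y y, t <= rnorm y & rnorm (x + y) < 1 + auc_modulus_at x t + e].
Proof.
move=> fY e0; have [_ [y [Yy yt] <-] Ye] := inf_adherent e0 (inner_inf fY).
exists y; split=> //; apply: lt_le_trans Ye _.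
rewrite lerD2r /auc_modulus_at [1 + _]addrCA subrr addr0.
by apply: sup_upper_bound => //; exists Y.
Qed.

(** A subspace witnessing both approximations contains a vector of norm
    exactly [t], which is admissible in both moduli. *)
Lemma auc_le_aus_modulus_at : auc_modulus_at x t <= aus_modulus_at x t.
Proof.
apply/ler_addgt0Pr => e e0; have e20 : 0 < e / 2 by rewrite divr_gt0.
have [Y1 fY1 H1] := aus_modulus_at_near e20.
have [Y2 fY2 H2] := auc_modulus_at_near e20.
have [Z fZ ZY] := closed_fincodim_directed fY1 fY2.
have [y Zy yt] := fincodim_sphere Xinf fZ t0.
have [Y1y Y2y] := ZY y Zy.
have := H1 y Y1y; have := H2 y Y2y; rewrite yt lexx => /(_ isT) ? /(_ isT) ?; lra.
Qed.

Lemma aus_modulus_at_le : aus_modulus_at x t <= rnorm x + t - 1.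
Proof.
rewrite /aus_modulus_at lerD2r; apply: (@le_trans _ _ (sup (outer setT))).
  by apply: ge_inf; [exact: outer_inf.2|exists setT => //; exact: closed_fincodimT].
apply: ge_sup; first exact: (outer_sup (closed_fincodimT X)).1.
by move=> _ [y [_ yt] <-]; apply: le_trans (ler_rnormD _ _) _; rewrite lerD2l.
Qed.

Lemma aus_modulus_at_ge : rnorm x - 1 <= aus_modulus_at x t.
Proof.
rewrite /aus_modulus_at lerD2r; apply: lb_le_inf; first exact: outer_inf.1.
by move=> _ [Y fY <-]; exact: outer_sup_ge.
Qed.

Lemma auc_modulus_at_ge : - 1 <= auc_modulus_at x t.
Proof.
rewrite /auc_modulus_at lerDr; apply: (@le_trans _ _ (inf (inner setT))).
  apply: lb_le_inf; first exact: (inner_inf (closed_fincodimT X)).1.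
  by move=> _ [y _ <-]; exact: rnorm_ge0.
by apply: sup_upper_bound => //; exists setT => //; exact: closed_fincodimT.
Qed.

End AtPoint.

Lemma aus_modulus_ub x t : 0 <= t -> unit_sphere x ->
  aus_modulus_at x t <= aus_modulus X t.
Proof.
move=> t0 x1; apply: ub_le_sup; last by exists x.
by exists t => _ [y y1 <-]; have := aus_modulus_at_le y t0; rewrite y1; lra.
Qed.

Lemma aus_modulus_le t (c : R) : 0 <= t ->
  (forall x, unit_sphere x -> aus_modulus_at x t <= c) -> aus_modulus X t <= c.
Proof.
move=> t0 xc; apply: ge_sup; last by move=> _ [x x1 <-]; exact: xc.
by have [x x1] := infinite_dimensional_sphere; exists (aus_modulus_at x t), x.
Qed.

Lemma auc_modulus_lb x t : 0 <= t -> unit_sphere x ->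
  auc_modulus X t <= auc_modulus_at x t.
Proof.
move=> t0 x1; apply: ge_inf; last by exists x.
by exists (- 1) => _ [y y1 <-]; exact: auc_modulus_at_ge.
Qed.

Lemma auc_modulus_ge t (c : R) : 0 <= t ->
  (forall x, unit_sphere x -> c <= auc_modulus_at x t) -> c <= auc_modulus X t.
Proof.
move=> t0 xc; apply: lb_le_inf; last by move=> _ [x x1 <-]; exact: xc.
by have [x x1] := infinite_dimensional_sphere; exists (auc_modulus_at x t), x.
Qed.

Lemma auc_le_aus_modulus t : 0 <= t -> auc_modulus X t <= aus_modulus X t.
Proof.
move=> t0; have [x x1] := infinite_dimensional_sphere.
apply: le_trans (auc_modulus_lb t0 x1) (le_trans _ (aus_modulus_ub t0 x1)).
exact: auc_le_aus_modulus_at.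
Qed.

Lemma aus_modulus_homo s t : 0 <= s -> s <= t -> aus_modulus X s <= aus_modulus X t.
Proof.
move=> s0 st; have t0 : 0 <= t by exact: le_trans st.
apply: aus_modulus_le => // x x1; apply: le_trans (aus_modulus_ub t0 x1).
apply/ler_addgt0Pr => e e0; have e20 : 0 < e / 2 by rewrite divr_gt0.
have [Y fY H] := aus_modulus_at_near x t0 e20.
have [y [Yy ys]] := aus_modulus_at_attained x s0 fY e20.
have := H y Yy (le_trans ys st); lra.
Qed.

Lemma aus_modulus0 : aus_modulus X 0 = 0.
Proof.
apply/eqP; rewrite eq_le; apply/andP; split.
  apply: aus_modulus_le => // x x1; have := aus_modulus_at_le x (lexx 0).
  by rewrite x1; lra.
have [x x1] := infinite_dimensional_sphere.
apply: le_trans (aus_modulus_ub (lexx 0) x1).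
by have := aus_modulus_at_ge x (lexx 0); rewrite x1; lra.
Qed.

End Moduli.

(** * Equal moduli imply stability and (sM) *)

Section EqualModuli.
Context (R : realType) (k : scalar_kind).
Local Notation K := (scalars R k).
Local Notation toK := (@of_real R k).
Variable X : normedModType K.
Hypothesis Xinf : infinite_dimensional X.
Hypothesis moduli_eq : forall t : R, 0 <= t -> auc_modulus X t = aus_modulus X t.
Implicit Types (x y : X).

(** Up to a small error, [z t] is a vector of norm exactly [s] in a prescribed
    subspace of finite codimension.  So [`|x + z t|] is squeezed between one
    plus the convexity modulus and one plus the smoothness modulus. *)
Lemma unit_sphere_limit (T : Type) (F : set_system T) (FF : ProperFilter F)
    (z : T -> X) x (s : R) : unit_sphere x -> weakly_null F z -> 0 <= s ->
  (fun t => rnorm (z t)) @ F --> s ->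
  (fun t => rnorm (x + z t)) @ F --> 1 + aus_modulus X s.
Proof.
move=> x1 wz s0 zs; apply/cvgrPdist_lt => e e0.
have e40 : 0 < e / 4 by rewrite divr_gt0.
have [Y1 fY1 H1] := aus_modulus_at_near x s0 e40.
have [Y2 fY2 H2] := auc_modulus_at_near Xinf x s0 e40.
have [Z fZ ZY] := closed_fincodim_directed fY1 fY2.
move/cvgrPdist_lt : zs => /(_ _ e40).
move: (weakly_null_near_fincodim FF wz fZ e40); apply: filterS2 => t [y Zy zy] tz.
have [y' Zy' [y's yy']] := fincodim_renorm Xinf fZ Zy s0.
have [Y1y Y2y] := ZY y' Zy'.
have := H1 _ Y1y; have := H2 _ Y2y; rewrite y's lexx => /(_ isT) lo /(_ isT) hi.
have := aus_modulus_ub s0 x1; have := auc_modulus_lb Xinf s0 x1.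
rewrite moduli_eq// => lo' hi'.
have := ler_dist_rnorm (z t) y; have := ler_rnormD (z t - y) (y - y').
have := ler_dist_rnorm (x + z t) (x + y').
rewrite yy' opprD addrACA subrr add0r addrA subrK.
move: tz => /=; rewrite !(ltr_norml, ler_norml) => /andP[? ?] /andP[? ?].
have [] := lerP 0 (rnorm y - s) => ys;
  [rewrite ger0_norm//|rewrite ltr0_norm//] => ? /andP[? ?]; lra.
Qed.

(** Division by [rnorm x] reduces this to the unit sphere; at the origin it is
    the normalization [NA X 0 s = s]. *)
Lemma NA_limit (T : Type) (F : set_system T) (FF : ProperFilter F)
    (z : T -> X) x (s : R) : weakly_null F z -> 0 <= s ->
  (fun t => rnorm (z t)) @ F --> s ->
  (fun t => rnorm (x + z t)) @ F --> NA X (rnorm x) s.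
Proof.
move=> wz s0 zs; rewrite /NA; have [/rnorm_eq0 -> {x}|x0] := eqVneq (rnorm x) 0.
  rewrite ger0_norm//; apply: cvg_trans zs; apply: near_eq_cvg.
  by apply: filterE => t; rewrite add0r.
set r := rnorm x in x0 *.
have r0 : 0 < r by rewrite lt0r x0 rnorm_ge0.
have rV (z' : X) : rnorm (toK r^-1 *: z') = r^-1 * rnorm z'.
  by rewrite rnormZr ger0_norm// invr_ge0 ltW.
have x1 : unit_sphere (toK r^-1 *: x) by rewrite /unit_sphere /= rV mulVf.
have sr0 : 0 <= s / r by rewrite divr_ge0// ltW.
have zr : (fun t => rnorm (toK r^-1 *: z t)) @ F --> s / r.
  under eq_fun do rewrite rV mulrC.
  exact: cvgM zs (cvg_cst _).
have := cvgM (cvg_cst r) (unit_sphere_limit FF x1 (weakly_nullZ FF (toK r^-1) wz) sr0 zr).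
rewrite (ger0_norm (ltW r0)) ger0_norm// mulrDr mulr1.
suff -> : (fun t => rnorm (x + z t)) =
  (fun t => r * rnorm (toK r^-1 *: x + toK r^-1 *: z t)) by exact.
by apply/funext => t; rewrite -scalerDr rV mulrA divff// mul1r.
Qed.

Arguments NA_limit {T F} FF {z} x {s}.

Hypothesis NA_sym : forall a b : R, NA X a b = NA X b a.

(** By symmetry the first argument may be read as the second one, where
    monotonicity is that of the smoothness modulus. *)
Lemma NA_homo (a b s : R) : 0 <= a -> a <= b -> 0 <= s -> NA X a s <= NA X b s.
Proof.
move=> a0 ab s0; rewrite !(NA_sym _ s) /NA; have b0 := le_trans a0 ab.
have [_|sn] := eqVneq s 0; first by rewrite !ger0_norm.
rewrite lerD2l; apply: ler_wpM2l => //; rewrite !ger0_norm ?divr_ge0//.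
apply: aus_modulus_homo => //; first exact: divr_ge0.
by rewrite ler_pM2r// invr_gt0 lt0r sn.
Qed.

(** Both values are limits of norms of translates of the same [z], by multiples
    [a x] and [b x] of one unit vector. *)
Lemma NA_lipschitz (a b s : R) (T : Type) (F : set_system T) (FF : ProperFilter F)
    (z : T -> X) : weakly_null F z -> 0 <= s ->
  (fun t => rnorm (z t)) @ F --> s -> 0 <= a -> 0 <= b ->
  NA X a s - NA X b s <= `|a - b|.
Proof.
move=> wz s0 zs a0 b0.
have [x x1] := infinite_dimensional_sphere Xinf.
have xn c : 0 <= c -> rnorm (toK c *: x) = c.
  by move=> c0; rewrite rnormZr x1 mulr1 ger0_norm.
have := NA_limit FF (toK a *: x) wz s0 zs; rewrite xn// => za.
have := NA_limit FF (toK b *: x) wz s0 zs; rewrite xn// => zb.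
apply: (limit_le FF (cvgB za zb) (cvg_cst _)); apply: filterE => t /=.
apply: le_trans (ler_rnormB _ _) _.
by rewrite opprD addrACA subrr addr0 -scalerBl -of_realN -of_realD rnormZr x1 mulr1.
Qed.

(** Otherwise some ultrafilter finer than the eventual sets contains all
    indices violating the inequality, against [NA_limit] and [NA_homo]. *)
Lemma eventually_le_norm (I : Type) (le : I -> I -> Prop) (z : I -> X) x y (e : R) :
  bounded_weakly_null_net le z -> rnorm y <= rnorm x -> 0 < e ->
  eventual_sets le [set i | rnorm (y + z i) <= rnorm (x + z i) + e].
Proof.
move=> [dle [M zM] wz] yx e0; have EF := eventual_filter dle; apply: contrapT => nE.
pose D (i : I) := [set j | le i j /\ rnorm (x + z j) + e < rnorm (y + z j)].
case: dle => [[i0] refl trans dir].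
have [||U [UU UD]] := @ultra_of_base I I D (inhabits i0).
- move=> i; apply: contrapT => Di; apply: nE; exists i => j ij /=.
  by rewrite leNgt; apply/negP => yj; apply: Di; exists j.
- move=> i j; have [l [il jl]] := dir i j; exists l => m [lm ?].
  by split; split=> //; [exact: trans lm|exact: trans lm].
have EU : eventual_sets le `<=` U.
  by move=> A [i iA]; move: (UD i); apply: filterS => j [/iA].
have wU : weakly_null U z by exact: weakly_null_fine EU wz.
have [|s s0 zs] := @ultra_rnorm_cvg R k X _ U UU z M; first by apply: filterE => t; exact: zM.
have PU : ProperFilter U by exact: ultra_proper.
have xs := NA_limit PU x wU s0 zs; have ys := NA_limit PU y wU s0 zs.
have : NA X (rnorm x) s + e <= NA X (rnorm y) s.
  apply: (limit_le PU (cvgD xs (cvg_cst e)) ys).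
  by move: (UD i0); apply: filterS => t [_ /ltW].
have := NA_homo (rnorm_ge0 y) yx s0; lra.
Qed.

Lemma equal_moduli_sM : property_sM X.
Proof.
move=> x y yx I le z bz; apply/lee_addgt0Pr => e e0.
have [i0 i0e] := eventually_le_norm bz yx e0.
case: bz => [[_ refl trans dir] _ _].
rewrite -leeBlDr//; apply: le_ereal_inf_tmp => _ [i _ <-].
rewrite leeBlDr//; have [j [i0j ij]] := dir i0 i.
apply: (@le_trans _ _ (ereal_sup [set (rnorm (y + z l))%:E | l in le j])).
  by apply: ereal_inf_lbound; exists j.
apply: ge_ereal_sup => _ [l jl <-].
apply: (@le_trans _ _ ((rnorm (x + z l) + e)%:E)).
  by rewrite lee_fin; apply: i0e; exact: trans jl.
rewrite EFinD leeD2r//; apply: ereal_sup_ubound; exists l => //; exact: trans jl.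
Qed.

(** The inner limit at [i] is [NA X (rnorm (x i)) t], and [NA] is continuous in
    its first argument. *)
Lemma iterated_lim_NA (I J : Type) (leI : I -> I -> Prop) (leJ : J -> J -> Prop)
    (x : I -> X) (y : J -> X) (U : set_system I) (V : set_system J)
    (UU : ProperFilter U) (VV : ProperFilter V) (s t l : R) :
  ProperFilter (eventual_sets leJ) ->
  eventual_sets leI `<=` U -> eventual_sets leJ `<=` V -> weakly_null V y ->
  0 <= s -> 0 <= t ->
  (fun i => rnorm (x i)) @ U --> s -> (fun j => rnorm (y j)) @ V --> t ->
  iterated_lim leI leJ (fun i j => rnorm (x i + y j)) l -> l = NA X s t.
Proof.
move=> EJ EU EV wy s0 t0 xs yt [g [xg gl]].
have gE i : g i = NA X (rnorm (x i)) t.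
  apply: limit_unique (NA_limit VV (x i) wy t0 yt).
  by move=> A /(xg i); exact: EV.
apply: (@limit_unique R I U UU g); first by move=> A /gl; exact: EU.
apply/cvgrPdist_lt => e e0; move/cvgrPdist_lt : xs => /(_ e e0).
apply: filterS => i /= si; rewrite gE; apply: le_lt_trans si.
have x0 := rnorm_ge0 (x i).
have h1 := NA_lipschitz VV wy t0 yt s0 x0; have h2 := NA_lipschitz VV wy t0 yt x0 s0.
by rewrite ler_norml lerNl opprB {1}distrC h1 h2.
Qed.

Lemma equal_moduli_weak_net_stable : weak_net_stable X.
Proof.
move=> I J leI leJ x y [dI [M xM] wx] [dJ [N yN] wy] l m lim_l lim_m.
have EI := eventual_filter dI; have EJ := eventual_filter dJ.
have [U [UU IU]] := ultraFilterLemma EI; have [V [VV JV]] := ultraFilterLemma EJ.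
have [|s s0 xs] := @ultra_rnorm_cvg R k X _ U UU x M; first by apply: filterE => i; exact: xM.
have [|t t0 yt] := @ultra_rnorm_cvg R k X _ V VV y N; first by apply: filterE => j; exact: yN.
have wU : weakly_null U x by exact: weakly_null_fine IU wx.
have wV : weakly_null V y by exact: weakly_null_fine JV wy.
rewrite (iterated_lim_NA _ _ EJ IU JV wV s0 t0 xs yt lim_l) NA_sym.
apply/esym; apply: (iterated_lim_NA _ _ EI JV IU wU t0 s0 yt xs).
case: lim_m => g [gl gm]; exists g; split=> // j.
by under eq_fun do rewrite addrC; exact: gl.
Qed.

End EqualModuli.

(** * Stability and (sM) imply equal moduli *)

Section StableSpace.
Context (R : realType) (k : scalar_kind).
Local Notation K := (scalars R k).
Local Notation toK := (@of_real R k).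
Variable X : normedModType K.
Hypothesis Xinf : infinite_dimensional X.
Implicit Types (x y : X) (Y : set X).

(** Used with [P e] the set of vectors that optimize a modulus up to [e]. *)
Lemma ultra_in_fincodim (P : R -> set X) :
  (forall d e, d <= e -> P d `<=` P e) ->
  (forall Y e, closed_fincodim Y -> 0 < e -> exists2 y, Y y & P e y) ->
  exists U : set_system X, [/\ UltraFilter U,
    forall Y, closed_fincodim Y -> U Y & forall e, 0 < e -> U (P e)].
Proof.
move=> Pmono Pex.
pose I := {q : set X * R | closed_fincodim q.1 /\ 0 < q.2}.
pose D (i : I) := (sval i).1 `&` P (sval i).2.
have exI Y e : closed_fincodim Y -> 0 < e -> exists i : I, D i = Y `&` P e.
  move=> fY e0; have q : closed_fincodim (Y, e).1 /\ 0 < (Y, e).2 by [].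
  by exists (exist _ (Y, e) q).
have [i0 _] := exI _ _ (closed_fincodimT X) ltr01.
have [||U [UU UD]] := @ultra_of_base X I D (inhabits i0).
- move=> [[Y e] /= [fY e0]]; have [y Yy Py] := Pex Y e fY e0.
  by exists y.
- move=> [[Y1 d] /= [fY1 d0]] [[Y2 e] /= [fY2 e0]].
  have [Z fZ ZY] := closed_fincodim_directed fY1 fY2.
  have [|i iE] := exI Z (Order.min d e) fZ; first by rewrite lt_min d0.
  exists i; rewrite iE => y [/ZY[Y1y Y2y] Py]; rewrite /D /=.
  by split; split=> //; apply: Pmono Py; rewrite ge_min lexx ?orbT.
exists U; split=> // [Y fY|e e0].
  have [i iE] := exI _ _ fY ltr01.
  by move: (UD i); rewrite iE; apply: filterS => y [].
have [i iE] := exI _ _ (closed_fincodimT X) e0.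
by move: (UD i); rewrite iE; apply: filterS => y [].
Qed.

Section Ultra.
Variables (U : set_system X) (UU : UltraFilter U) (M : R).
Hypothesis Ufin : forall Y, closed_fincodim Y -> U Y.
Hypothesis UM : U [set u | rnorm u <= M].

Let PU : ProperFilter U. Proof. exact: ultra_proper. Qed.
Let B := [set u : X | rnorm u <= M].
Let le := @filter_net_le X U B.
Let net := @filter_net X U B.

(** The kernel of a continuous functional is closed of finite codimension, so
    the functional vanishes eventually. *)
Lemma filter_net_weakly_null : bounded_weakly_null_net le net.
Proof.
split; first exact: (filter_net_directed PU UM).
  by exists M => p; have [] := svalP p.
move=> f cf A A0; apply: (@filter_net_eventual X U PU B UM (f @^-1` A)).
have := Ufin (closed_fincodim_ker cf (closed_fincodimT X)).
by apply: filterS => u [_ /= fu]; rewrite /= fu; exact: nbhs_singleton.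
Qed.

Lemma sM_limit_le x y (a b : R) : property_sM X -> rnorm y <= rnorm x ->
  (fun u => rnorm (y + u)) @ U --> a -> (fun u => rnorm (x + u)) @ U --> b ->
  a <= b.
Proof.
move=> sM yx ya xb; apply/ler_addgt0Pr => e e0.
have e20 : 0 < e / 2 by rewrite divr_gt0.
have := sM x y yx _ _ _ filter_net_weakly_null.
move/cvgrPdist_lt : ya => /(_ _ e20) ya; move/cvgrPdist_lt : xb => /(_ _ e20) xb.
have lo : ((a - e / 2)%R%:E <= net_limsup le (fun p => rnorm (y + net p)%R))%E.
  apply: net_limsup_ge; first exact: (filter_net_directed PU UM).
  apply: (@filter_net_eventual X U PU B UM [set u | a - e / 2 <= rnorm (y + u)]).
  by move: ya; apply: filterS => u /=; rewrite ltr_norml => /andP[]; lra.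
have hi : (net_limsup le (fun p => rnorm (x + net p)%R) <= (b + e / 2)%R%:E)%E.
  apply: net_limsup_le.
  apply: (@filter_net_eventual X U PU B UM [set u | rnorm (x + u) <= b + e / 2]).
  by move: xb; apply: filterS => u /=; rewrite ltr_norml => /andP[]; lra.
move=> mid; have := le_trans lo (le_trans mid hi); rewrite lee_fin; lra.
Qed.

Lemma ultra_translate_cvg x : exists l : R, (fun u => rnorm (x + u)) @ U --> l.
Proof.
apply: (@ultra_bounded_cvg R X U UU _ (rnorm x + M)).
move: UM; apply: filterS => u /= uM; rewrite ger0_norm ?rnorm_ge0//.
by apply: le_trans (ler_rnormD _ _) _; rewrite lerD2l.
Qed.

End Ultra.

(** The two families of vectors meet in the double limit of [`|u + v|].
    By (sM), replacing [u] by the longer [x] does not decrease the limit over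
    [v], and replacing [v] by the shorter [y] does not increase the limit over
    [u]. *)
Lemma weak_net_stable_cross x y (a b : R) : weak_net_stable X -> property_sM X ->
  (forall Y e, closed_fincodim Y -> 0 < e ->
    exists2 u, Y u & rnorm u <= rnorm x /\ a - e < rnorm (y + u)) ->
  (forall Y e, closed_fincodim Y -> 0 < e ->
    exists2 v, Y v & rnorm y <= rnorm v /\ rnorm (x + v) < b + e) ->
  a <= b.
Proof.
move=> stable sM Hu Hv.
have [|U [UU Ufin UP]] := ultra_in_fincodim _ Hu.
  by move=> d e de u [ux yu]; split=> //; lra.
have [|V [VV Vfin VP]] := ultra_in_fincodim _ Hv.
  by move=> d e de v [yv xv]; split=> //; lra.
have PU : ProperFilter U by exact: ultra_proper.
have PV : ProperFilter V by exact: ultra_proper.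
have UM : U [set u | rnorm u <= rnorm x].
  by move: (UP 1 ltr01); apply: filterS => u [].
have VM : V [set v | rnorm v <= rnorm x + b + 1].
  move: (VP 1 ltr01); apply: filterS => v [_] /= xv.
  by have := ler_rnormD (x + v) (- x); rewrite rnormN addrAC subrr add0r; lra.
have [g gV] := choice (ultra_translate_cvg VV VM).
have [h hU] := choice (ultra_translate_cvg UU UM).
have [bx xb] := ultra_translate_cvg VV VM x.
have [ay ya] := ultra_translate_cvg UU UM y.
have ab : a <= ay.
  apply/ler_addgt0Pr => e e0; rewrite -lerBlDr; apply: (limit_le PU (cvg_cst _) ya).
  by move: (UP e e0); apply: filterS => u [_ /ltW].
have bb : bx <= b.
  apply/ler_addgt0Pr => e e0; apply: (limit_le PV xb (cvg_cst _)).
  by move: (VP e e0); apply: filterS => v [_ /ltW].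
have g_le u : rnorm u <= rnorm x -> g u <= bx.
  by move=> ux; apply: (sM_limit_le VV Vfin VM sM ux (gV u) xb).
have h_ge v : rnorm y <= rnorm v -> ay <= h v.
  by move=> yv; apply: (sM_limit_le UU Ufin UM sM yv ya (hU v)).
have g_bound u : rnorm u <= rnorm x -> `|g u| <= rnorm x + (rnorm x + b + 1).
  move=> ux; rewrite ger0_norm; last first.
    by apply: (limit_le PV (cvg_cst 0) (gV u)); apply: filterE => v; exact: rnorm_ge0.
  apply: (limit_le PV (gV u) (cvg_cst _)); move: VM; apply: filterS => v /= vM.
  by apply: le_trans (ler_rnormD _ _) _; apply: lerD.
have h_bound v : rnorm v <= rnorm x + b + 1 -> `|h v| <= rnorm x + (rnorm x + b + 1).
  move=> vM; rewrite ger0_norm; last first.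
    by apply: (limit_le PU (cvg_cst 0) (hU v)); apply: filterE => u; exact: rnorm_ge0.
  apply: (limit_le PU (hU v) (cvg_cst _)); move: UM; apply: filterS => u /= ux.
  by apply: le_trans (ler_rnormD _ _) _; rewrite addrC; apply: lerD.
have [|l gl] := @ultra_bounded_cvg R X U UU g (rnorm x + (rnorm x + b + 1)).
  by move: UM; apply: filterS => u /g_bound.
have [|m hm] := @ultra_bounded_cvg R X V VV h (rnorm x + (rnorm x + b + 1)).
  by move: VM; apply: filterS => v /h_bound.
have lb : l <= bx.
  by apply: (limit_le PU gl (cvg_cst _)); move: UM; apply: filterS => u /g_le.
have am : ay <= m.
  apply: (limit_le PV (cvg_cst _) hm); move: (VP 1 ltr01); apply: filterS => v [yv _].
  exact: h_ge.
suff lm : l = m by lra.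
apply: (stable _ _ _ _ _ _ (filter_net_weakly_null UU Ufin UM)
                           (filter_net_weakly_null VV Vfin VM)).
  exists (g \o @filter_net X U _); split; last exact: (filter_net_cvg PU UM).
  by move=> p; apply: (filter_net_cvg PV VM) (gV _).
exists (h \o @filter_net X V _); split; last exact: (filter_net_cvg PV VM).
have hU' v : (fun u => rnorm (u + v)) @ U --> h v.
  suff -> : (fun u => rnorm (u + v)) = (fun u => rnorm (v + u)) by exact: hU.
  by apply/funext => u; rewrite addrC.
by move=> p; apply: (filter_net_cvg PU UM) (hU' _).
Qed.

Hypothesis NA_sym : forall a b : R, NA X a b = NA X b a.
Hypothesis stable : weak_net_stable X.
Hypothesis sM : property_sM X.

(** For [t > 0], [weak_net_stable_cross] bounds [t A(x', 1/t)] for each unit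
    vector [x'], hence [t (1 + rho(1/t)) = NA t 1], which is [1 + rho(t)] by
    symmetry. *)
Lemma aus_modulus_le_auc_modulus_at x (t : R) : 0 <= t -> unit_sphere x ->
  aus_modulus X t <= auc_modulus_at x t.
Proof.
move=> t0 x1; have minimizing y : rnorm y = t -> forall Y e, closed_fincodim Y -> 0 < e ->
    exists2 v, Y v & rnorm y <= rnorm v /\ rnorm (x + v) < 1 + auc_modulus_at x t + e.
  move=> yt Y e fY e0; have [v [Yv tv xv]] := auc_modulus_at_attained Xinf x t0 fY e0.
  by exists v => //; rewrite yt.
have [t_eq0|tn0] := eqVneq t 0.
  rewrite {1}t_eq0 aus_modulus0// -(lerD2l 1) addr0.
  apply: (@weak_net_stable_cross x 0 _ _ stable sM) (minimizing 0 _); last first.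
    by rewrite rnorm0.
  move=> Y e fY e0; have [u Yu u1] := fincodim_sphere Xinf fY ler01.
  by exists u => //; rewrite add0r u1 x1 lexx; split=> //; lra.
have t_gt0 : 0 < t by rewrite lt0r tn0.
have tV0 : 0 <= t^-1 by rewrite invr_ge0.
have : t * (1 + aus_modulus X t^-1) <= 1 + auc_modulus_at x t.
  rewrite mulrC -ler_pdivlMr// -lerBrDl.
  apply: aus_modulus_le => // y y1; rewrite lerBrDl ler_pdivlMr// mulrC.
  apply: (@weak_net_stable_cross x (toK t *: y) _ _ stable sM) (minimizing _ _); last first.
    by rewrite rnormZr y1 mulr1 ger0_norm.
  move=> Y e fY e0; have et0 : 0 < e / t by rewrite divr_gt0.
  have [u [Yu ut yu]] := aus_modulus_at_attained y tV0 fY et0.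
  have sY : subspace Y by case: fY => /subspaceP.
  exists (toK t *: u); first exact: (subspaceZ sY).
  rewrite -scalerDr !rnormZr (ger0_norm t0) x1; split.
    by rewrite -(mulfV tn0) ler_wpM2l.
  by move: yu; rewrite -(ltr_pM2l t_gt0) mulrBr [t * (e / t)]mulrC divfK.
have := NA_sym t 1; rewrite /NA (negPf tn0) oner_eq0 !normr1 !mul1r divr1.
rewrite !(ger0_norm t0) ger0_norm// mulrDr mulr1 => -> ; lra.
Qed.

Lemma stable_sM_equal_moduli t : 0 <= t -> auc_modulus X t = aus_modulus X t.
Proof.
move=> t0; apply/eqP; rewrite eq_le auc_le_aus_modulus//=.
by apply: auc_modulus_ge => // x; exact: aus_modulus_le_auc_modulus_at.
Qed.

End StableSpace.

Theorem theorem5p10 (R : realType) (k : scalar_kind)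
    (X : completeNormedModType (scalars R k)) :
  infinite_dimensional X ->
  (forall a b : R, NA X a b = NA X b a) ->
  (weak_net_stable X /\ property_sM X) <->
  (forall t : R, 0 <= t -> auc_modulus X t = aus_modulus X t).
Proof.
move=> Xinf NA_sym; split=> [[stable sM] t|moduli_eq].
  exact: stable_sM_equal_moduli.
split; [exact: equal_moduli_weak_net_stable|exact: equal_moduli_sM].
Qed.
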